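(* The class $\mathcal{LO}_r$ of linearly ordered sets with one order reversing unary operation has the amalgamation property but not the strong amalgamation property; likewise, the class $\mathcal{LO}_{sr}$ of linearly ordered sets with one strict order reversing unary operation has the amalgamation property but not the strong amalgamation property. (Strong amalgamation fails even when the bottom structure of the amalgamation triple is required to be nonempty.)
   Context: A unary $g$ on an ordered set is order reversing if $a\le b$ implies $g(a)\ge g(b)$, strict order reversing if $a<b$ implies $g(a)>g(b)$. Embeddings are injective maps commuting with the operation and satisfying $x\le y\iff\iota(x)\le\iota(y)$. A class $\mathcal K$ has the amalgamation property (AP) if whenever $\mathbf A,\mathbf B,\mathbf C\in\mathcal K$ and $\iota_1:\mathbf C\to\mathbf A$, $\iota_2:\mathbf C\to\mathbf B$ are embeddings, there exist $\mathbf D\in\mathcal K$ and embeddings $j_1:\mathbf A\to\mathbf D$, $j_2:\mathbf B\to\mathbf D$ with $j_1\circ\iota_1=j_2\circ\iota_2$; it has the strong amalgamation property (SAP) if moreover these can always be chosen so that $j_1(A)\cap j_2(B)=j_1(\iota_1(C))$. *)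

(* Defs.v *)
From mathcomp Require Import all_boot all_order.
From mathcomp Require Import boolp classical_sets.

Set Implicit Arguments.
Unset Strict Implicit.
Unset Printing Implicit Defensive.

Local Open Scope order_scope.
Local Open Scope classical_set_scope.

(* A linearly ordered set with one unary operation; the carrier may be empty.
   The display is a notational tag and carries no mathematical content. *)
Record unaryLO := UnaryLO {
  ulo_disp : Order.disp_t;
  ulo_sort :> orderType ulo_disp;
  ulo_op : ulo_sort -> ulo_sort
}.

Definition order_reversing (A : unaryLO) : Prop :=
  forall a b : A, a <= b -> ulo_op b <= ulo_op a.

Definition strict_order_reversing (A : unaryLO) : Prop :=
  forall a b : A, a < b -> ulo_op b < ulo_op a.

Definition LO_r (A : unaryLO) : Prop := order_reversing A.
Definition LO_sr (A : unaryLO) : Prop := strict_order_reversing A.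

Definition embedding (A B : unaryLO) (i : A -> B) : Prop :=
  [/\ injective i,
      forall x : A, i (ulo_op x) = ulo_op (i x) &
      forall x y : A, x <= y <-> i x <= i y].

Definition amalgam (A B C D : unaryLO) (i1 : C -> A) (i2 : C -> B)
    (j1 : A -> D) (j2 : B -> D) : Prop :=
  [/\ embedding j1, embedding j2 & j1 \o i1 = j2 \o i2].

Definition strong_amalgam (A B C D : unaryLO) (i1 : C -> A) (i2 : C -> B)
    (j1 : A -> D) (j2 : B -> D) : Prop :=
  amalgam i1 i2 j1 j2 /\ range j1 `&` range j2 = j1 @` range i1.

Definition AP (K : unaryLO -> Prop) : Prop :=
  forall (A B C : unaryLO) (i1 : C -> A) (i2 : C -> B),
    K A -> K B -> K C -> embedding i1 -> embedding i2 ->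
    exists (D : unaryLO) (j1 : A -> D) (j2 : B -> D),
      K D /\ amalgam i1 i2 j1 j2.

Definition SAP (K : unaryLO -> Prop) : Prop :=
  forall (A B C : unaryLO) (i1 : C -> A) (i2 : C -> B),
    K A -> K B -> K C -> embedding i1 -> embedding i2 ->
    exists (D : unaryLO) (j1 : A -> D) (j2 : B -> D),
      K D /\ strong_amalgam i1 i2 j1 j2.

Definition SAP_nonempty (K : unaryLO -> Prop) : Prop :=
  forall (A B C : unaryLO) (i1 : C -> A) (i2 : C -> B),
    inhabited C ->
    K A -> K B -> K C -> embedding i1 -> embedding i2 ->
    exists (D : unaryLO) (j1 : A -> D) (j2 : B -> D),
      K D /\ strong_amalgam i1 i2 j1 j2.

(* Main.v *)
(* An order reversing map g has at most one fixed point, so fixed points present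
   in A and in B but not in C must be identified: this kills strong amalgamation.

   For amalgamation, compare points of A and B by the lexicographic order, with
   alternating signs, of the gaps of C in which the iterates x, g x, g (g x), ...
   lie, where C is refined by the (possibly virtual) fixed point.  Points with the
   same itinerary lie on the same side of the fixed point, and g swaps the two
   sides; hence putting A before B below the fixed point and B before A above it
   is compatible with g.  The amalgam is the quotient of A + B by the resulting
   total preorder.  Two points of A and B with the same itinerary are identified
   when they lie in C, or, in the strict case (where g is injective), as soon as
   some iterate does. *)

Require Import Defs.
From HB Require Import structures.
From mathcomp Require Import all_boot all_order.
From mathcomp Require Import generic_quotient boolp classical_sets.

Set Implicit Arguments.
Unset Strict Implicit.
Unset Printing Implicit Defensive.

Import Order.TTheory.
Local Open Scope order_scope.
Local Open Scope quotient_scope.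

(** * Order reversing maps on linear orders *)

Lemma strict_order_reversing_weak (A : unaryLO) :
  strict_order_reversing A -> order_reversing A.
Proof. by move=> sA a b; rewrite le_eqVlt => /predU1P[->//|/sA/ltW]. Qed.

Lemma strict_order_reversingE (A : unaryLO) :
  strict_order_reversing A -> forall a b : A, (ulo_op b <= ulo_op a) = (a <= b).
Proof.
move=> sA a b; apply/idP/idP; last exact: strict_order_reversing_weak.
by rewrite !leNgt; apply: contra => /sA.
Qed.

Lemma strict_order_reversing_inj (A : unaryLO) :
  strict_order_reversing A -> injective (@ulo_op A).
Proof.
move=> sA a b e; apply/le_anti/andP.
by split; rewrite -strict_order_reversingE// e.
Qed.

Lemma order_reversing_fixpoint_unique (A : unaryLO) (a b : A) :
  order_reversing A -> ulo_op a = a -> ulo_op b = b -> a = b.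
Proof.
move=> rA fa fb; case/orP: (le_total a b) => lab; apply/le_anti; rewrite lab ?andbT /=.
  by have := rA _ _ lab; rewrite fa fb.
by have := rA _ _ lab; rewrite fa fb.
Qed.

(** * Quotient of a total preorder carrying an antitone map *)

Section TotalPreorderQuotient.
Context (X : choiceType) (R : X -> X -> Prop) (g : X -> X).
Hypothesis R_total : forall x y, R x y \/ R y x.
Hypothesis R_trans : forall x y z, R x y -> R y z -> R x z.
Hypothesis R_anti : forall x y, R x y -> R (g y) (g x).

Let R_refl x : R x x. Proof. by case: (R_total x x). Qed.

Definition preorder_eq : rel X := fun x y => `[< R x y /\ R y x >].

Lemma preorder_eq_equiv : equiv_class_of preorder_eq.
Proof.
split=> [x|x y|y x z].
- by apply/asboolP.
- by apply/asboolP/asboolP => -[].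
- by move=> /asboolP[? ?] /asboolP[? ?]; apply/asboolP; split; apply: R_trans; eauto.
Qed.

Canonical preorder_eq_equiv_rel := EquivRelPack preorder_eq_equiv.

Definition preorder_quot := {eq_quot preorder_eq}.
HB.instance Definition _ := Choice.on preorder_quot.

Definition quot_pi (x : X) : preorder_quot := \pi_({eq_quot preorder_eq}) x.
Definition quot_repr (u : preorder_quot) : X := repr (u : {eq_quot preorder_eq}).

Lemma quot_reprK : cancel quot_repr quot_pi.
Proof. exact: reprK. Qed.

Lemma quot_piP x : R (quot_repr (quot_pi x)) x /\ R x (quot_repr (quot_pi x)).
Proof.
by apply/asboolP; apply/(@eqmodP _ preorder_eq_equiv_rel); exact: reprK.
Qed.

Definition quot_le : rel preorder_quot :=
  fun u v => `[< R (quot_repr u) (quot_repr v) >].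

Fact quot_le_refl : reflexive quot_le.
Proof. by move=> u; apply/asboolP. Qed.

Fact quot_le_anti : antisymmetric quot_le.
Proof.
move=> u v /andP[/asboolP uv /asboolP vu].
rewrite -[u]quot_reprK -[v]quot_reprK.
by apply/(@eqmodP _ preorder_eq_equiv_rel)/asboolP.
Qed.

Fact quot_le_trans : transitive quot_le.
Proof. by move=> v u w /asboolP uv /asboolP vw; apply/asboolP/(R_trans uv). Qed.

Fact quot_le_total : total quot_le.
Proof.
by move=> u v; case: (R_total (quot_repr u) (quot_repr v)) => uv;
  apply/orP; [left|right]; apply/asboolP.
Qed.

Fact quot_display : Order.disp_t. Proof. exact: Order.Disp tt tt. Qed.

HB.instance Definition _ := Order.Le_isPOrder.Build quot_display preorder_quot
  quot_le_refl quot_le_anti quot_le_trans.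
HB.instance Definition _ :=
  Order.POrder_isTotal.Build quot_display preorder_quot quot_le_total.

(** The operation acts on chosen representatives; [quot_pi_op] derives from antitonicity that the
    choice does not matter. *)
Definition quot_ulo : unaryLO :=
  @UnaryLO quot_display preorder_quot (fun u => quot_pi (g (quot_repr u))).

Lemma quot_pi_le x y : (quot_pi x : quot_ulo) <= quot_pi y <-> R x y.
Proof.
have [xl xr] := quot_piP x; have [yl yr] := quot_piP y.
by split=> [/asboolP|xy]; [|apply/asboolP]; eauto.
Qed.

Lemma quot_pi_op x : quot_pi (g x) = ulo_op (quot_pi x : quot_ulo).
Proof.
have [xl xr] := quot_piP x; apply/le_anti/andP.
by split; apply/quot_pi_le/R_anti.
Qed.

End TotalPreorderQuotient.

(** * Positions of points relative to the markers *)

(* The gaps of [C] have to be refined by the place where the unique fixed point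
   of the operation sits or would sit: the marker [None] stands for that point,
   and [x] lies below it iff [x <= ulo_op x]. *)
Section Markers.
Context (C S : unaryLO) (i : C -> S).
Hypothesis rS : order_reversing S.
Hypothesis iP : embedding i.

Definition marker_op (m : option C) : option C := omap (@ulo_op C) m.

(** Not antisymmetric: a fixed point [c] of [C] makes [Some c] and [None] equivalent. *)
Definition marker_le (m n : option C) : bool :=
  match m, n with
  | Some c, Some d => c <= d
  | Some c, None => c <= ulo_op c
  | None, Some d => ulo_op d <= d
  | None, None => true
  end.

Definition below (s : S) (m : option C) : bool :=
  if m is Some c then s <= i c else s <= ulo_op s.

Definition above (s : S) (m : option C) : bool :=
  if m is Some c then i c <= s else ulo_op s <= s.

Let i_le c d : (i c <= i d) = (c <= d).
Proof. by case: iP => _ _ h; apply/idP/idP => /h. Qed.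

Let i_op c : ulo_op (i c) = i (ulo_op c).
Proof. by case: iP. Qed.

Lemma below_or_above s m : below s m || above s m.
Proof. by case: m => [c|]; exact: le_total. Qed.

Lemma below_le s t m : s <= t -> below t m -> below s m.
Proof.
move=> st; case: m => [c|] /=; first exact: le_trans.
by move=> tg; apply: le_trans st (le_trans tg (rS st)).
Qed.

Lemma above_le s t m : s <= t -> above s m -> above t m.
Proof.
move=> st; case: m => [c|] /= h; first exact: le_trans h st.
exact: le_trans (rS st) (le_trans h st).
Qed.

(** A point both below and above [Some c] is [i c]; one both below and above [None] is a fixed
    point, and there is at most one. *)
Lemma exact_eq s t m :
  below s m -> above s m -> below t m -> above t m -> s = t.
Proof.
case: m => [c|] /= bs a_s bt a_t.
  by apply/le_anti; rewrite (le_trans bs a_t) (le_trans bt a_s).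
by apply: order_reversing_fixpoint_unique => //; apply/le_anti/andP.
Qed.

Lemma below_op s m : below s m -> above (ulo_op s) (marker_op m).
Proof. by case: m => [c|] /= /rS; rewrite ?i_op. Qed.

Lemma above_op s m : above s m -> below (ulo_op s) (marker_op m).
Proof. by case: m => [c|] /= /rS; rewrite ?i_op. Qed.

Lemma above_below_marker_le s m n : above s m -> below s n -> marker_le m n.
Proof.
case: m n => [c|] [d|] //= ams bns.
- by rewrite -i_le; apply: le_trans ams bns.
- by rewrite -i_le -i_op (le_trans ams)// (le_trans bns)// rS.
- by rewrite -i_le -i_op (le_trans _ bns)// (le_trans _ ams)// rS.
Qed.

Lemma marker_le_above s m n : marker_le m n -> above s n -> above s m.
Proof.
case: m n => [c|] [d|] //= mn ans.
- by apply: le_trans ans; rewrite i_le.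
(* With [g] the operation, [s < i c] would give [i c <= g (i c) <= g s <= s]. *)
- rewrite leNgt; apply/negP => sc; have := le_lt_trans ans sc.
  apply/negP; rewrite -leNgt; apply: le_trans (rS (ltW sc)).
  by rewrite i_op i_le.
- apply: le_trans (rS ans) (le_trans _ ans).
  by rewrite i_op i_le.
Qed.

Lemma marker_le_below s m n : marker_le m n -> below s m -> below s n.
Proof.
case: m n => [c|] [d|] //= mn bns.
- by apply: le_trans bns _; rewrite i_le.
- apply: le_trans bns (le_trans _ (rS bns)).
  by rewrite i_op i_le.
- rewrite leNgt; apply/negP => sc; have := lt_le_trans sc bns.
  apply/negP; rewrite -leNgt; apply: le_trans (rS (ltW sc)) _.
  by rewrite i_op i_le.
Qed.

(** A strict operation also reflects the order, which gives a converse to [above_op]. *)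
Lemma above_op_strict s m :
  strict_order_reversing S -> below (ulo_op s) (marker_op m) -> above s m.
Proof. by move=> sS; case: m => [c|] /=; rewrite -?i_op strict_order_reversingE. Qed.

Lemma below_op_strict s m :
  strict_order_reversing S -> above (ulo_op s) (marker_op m) -> below s m.
Proof. by move=> sS; case: m => [c|] /=; rewrite -?i_op strict_order_reversingE. Qed.

Lemma exact_embedding c : below (i c) (Some c) /\ above (i c) (Some c).
Proof. by rewrite /= lexx. Qed.

End Markers.

(** * Comparison of points of [A + B] by cuts and itineraries *)

Section Amalgamation.
Context (A B C : unaryLO) (i1 : C -> A) (i2 : C -> B).
Hypotheses (rA : order_reversing A) (rB : order_reversing B).
Hypotheses (i1P : embedding i1) (i2P : embedding i2).

Local Notation X := (A + B)%type.
Implicit Types (x y z : X) (m n : option C).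

Definition sum_op (x : X) : X :=
  match x with inl a => inl (ulo_op a) | inr b => inr (ulo_op b) end.

Definition sum_below (x : X) (m : option C) : bool :=
  match x with inl a => below i1 a m | inr b => below i2 b m end.

Definition sum_above (x : X) (m : option C) : bool :=
  match x with inl a => above i1 a m | inr b => above i2 b m end.

(** The point sits at the marker: it is the image of [c] for [Some c], and a fixed point for
    [None]. *)
Definition sum_exact x m := sum_below x m /\ sum_above x m.

Definition same_side_le (x y : X) : Prop :=
  match x, y with
  | inl a, inl a' => a <= a'
  | inr b, inr b' => b <= b'
  | _, _ => False
  end.

Lemma sum_below_or_above x m : sum_below x m || sum_above x m.
Proof. by case: x => ?; exact: below_or_above. Qed.

Lemma sum_above_below_marker_le x m n :
  sum_above x m -> sum_below x n -> marker_le m n.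
Proof. by case: x => ?; exact: above_below_marker_le. Qed.

Lemma marker_le_sum_above x m n : marker_le m n -> sum_above x n -> sum_above x m.
Proof. by case: x => ?; exact: marker_le_above. Qed.

Lemma marker_le_sum_below x m n : marker_le m n -> sum_below x m -> sum_below x n.
Proof. by case: x => ?; exact: marker_le_below. Qed.

Lemma sum_below_op x m : sum_below x m -> sum_above (sum_op x) (marker_op m).
Proof. by case: x => ?; exact: below_op. Qed.

Lemma sum_above_op x m : sum_above x m -> sum_below (sum_op x) (marker_op m).
Proof. by case: x => ?; exact: above_op. Qed.

Lemma sum_exact_op x m : sum_exact x m -> sum_exact (sum_op x) (marker_op m).
Proof. by case=> /sum_below_op ? /sum_above_op ?. Qed.

(** When it holds both ways, [x] and [y] lie in the same gap or at the same marker. *)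
Definition cut_le x y :=
  forall m, (sum_above x m -> sum_above y m) /\ (sum_below y m -> sum_below x m).

Lemma cut_le_trans x y z : cut_le x y -> cut_le y z -> cut_le x z.
Proof. by move=> xy yz m; have [? ?] := xy m; have [? ?] := yz m; split; auto. Qed.

(** Any marker below [x] is below [m], hence below [y]; dually for markers above [y]. *)
Lemma marker_cut_le x y m : sum_below x m -> sum_above y m -> cut_le x y.
Proof.
move=> xm my n; split=> h.
  by apply: marker_le_sum_above my; apply: sum_above_below_marker_le h xm.
by apply: marker_le_sum_below xm; apply: sum_above_below_marker_le my h.
Qed.

Lemma not_cut_leP x y : ~ cut_le y x ->
  exists2 m, sum_below x m /\ sum_above y m & ~ (sum_above x m /\ sum_below y m).
Proof.
move=> /existsNP[m nm]; exists m; last first.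
  by move=> [ax b_y]; apply: nm; split=> _.
have := sum_below_or_above x m; have := sum_below_or_above y m.
case: (sum_below x m) nm; case: (sum_above x m); case: (sum_below y m);
  case: (sum_above y m) => //= nm; by case: nm.
Qed.

Lemma cut_le_total x y : cut_le x y \/ cut_le y x.
Proof.
have [?|/not_cut_leP[m [xm my] _]] := pselect (cut_le y x); [by right|left].
exact: marker_cut_le xm my.
Qed.

Lemma same_side_cut_le x y : same_side_le x y -> cut_le x y.
Proof.
by case: x y => [a|b] [a'|b'] //= xy m; split;
  [apply: above_le|apply: below_le|apply: above_le|apply: below_le].
Qed.

(* The lexicographic comparison of the sequences of gaps of the iterates
   x, g x, g (g x), ..., with the sign alternating along the sequence. *)
Inductive itinerary_lt : X -> X -> Prop :=
| itinerary_lt_cut x y : ~ cut_le y x -> itinerary_lt x y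
| itinerary_lt_op x y : cut_le x y ->
    itinerary_lt (sum_op y) (sum_op x) -> itinerary_lt x y.

Lemma itinerary_ltP x y : itinerary_lt x y ->
  cut_le x y /\ (~ cut_le y x \/ itinerary_lt (sum_op y) (sum_op x)).
Proof.
case=> {}x {}y.
  by move=> nyx; split; [case: (cut_le_total x y)|left].
by move=> xy lt; split=> //; right.
Qed.

Lemma itinerary_lt_asym x y : itinerary_lt x y -> ~ itinerary_lt y x.
Proof.
elim=> {}x {}y; first by move=> nyx /itinerary_ltP[].
by move=> xy _ IH /itinerary_ltP[yx [//|]].
Qed.

(** Negative transitivity: together with asymmetry it makes [itinerary_lt] a strict weak order and
    [itinerary_eq] an equivalence. *)
Lemma itinerary_lt_split x y z :
  itinerary_lt x y -> itinerary_lt x z \/ itinerary_lt z y.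
Proof.
move=> lt; elim: lt z => {}x {}y => [nyx z|xy _ IH z].
  have [zx|?] := pselect (cut_le z x); last by left; apply: itinerary_lt_cut.
  right; apply: itinerary_lt_cut => yz; apply: nyx; exact: cut_le_trans yz zx.
have [zx|?] := pselect (cut_le z x); last by left; apply: itinerary_lt_cut.
have [yz|?] := pselect (cut_le y z); last by right; apply: itinerary_lt_cut.
(* All three cuts agree, so the comparison passes to the images, with the two sides exchanged. *)
have zy := cut_le_trans zx xy; have xz := cut_le_trans xy yz.
by case: (IH (sum_op z)) => h; [right|left]; apply: itinerary_lt_op.
Qed.

(** Points at a common marker have all their iterates at common markers, so no cut ever separates
    them. *)
Lemma itinerary_lt_exact x y m :
  itinerary_lt x y -> sum_exact x m -> sum_exact y m -> False.
Proof.
move=> lt; elim: lt m => {}x {}y => [nyx m [? ?] [? ?]|_ _ IH m ex ey].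
  by apply: nyx; apply: (@marker_cut_le _ _ m).
exact: (IH (marker_op m) (sum_exact_op ey) (sum_exact_op ex)).
Qed.

Lemma same_side_itinerary x y : itinerary_lt x y -> ~ same_side_le y x.
Proof.
elim=> {}x {}y => [nyx /same_side_cut_le //|_ _ IH yx].
by apply: IH; case: x y yx => [a|b] [a'|b'] //=; [apply: rA|apply: rB].
Qed.

Lemma cut_le_exact x y m : cut_le x y -> cut_le y x -> sum_exact x m -> sum_exact y m.
Proof. by move=> xy yx [? ?]; have [? _] := xy m; have [_ ?] := yx m; split; auto. Qed.

(** If a marker [m] separates [x] from [y], the images satisfy [g y <= g m <= g x]; the strict
    comparison is lost only when both images sit at [g m]. *)
Lemma itinerary_lt_op_collapse x y : itinerary_lt x y ->
  itinerary_lt (sum_op y) (sum_op x) \/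
  exists m, sum_exact (sum_op x) m /\ sum_exact (sum_op y) m.
Proof.
move=> /itinerary_ltP[xy [|]]; last by left.
move=> /not_cut_leP[m [xm my] _].
have [gxy|?] := pselect (cut_le (sum_op x) (sum_op y)); last first.
  by left; apply: itinerary_lt_cut.
have gx := sum_below_op xm; have gy := sum_above_op my.
by right; exists (marker_op m); have [h1 h2] := gxy (marker_op m); do 2!split; auto.
Qed.

Definition itinerary_eq x y := ~ itinerary_lt x y /\ ~ itinerary_lt y x.

Lemma itinerary_eq_cut_le x y : itinerary_eq x y -> cut_le x y.
Proof. by move=> [_ nyx]; apply: contrapT => /itinerary_lt_cut. Qed.

Lemma itinerary_eq_sym x y : itinerary_eq x y -> itinerary_eq y x.
Proof. by case. Qed.

Lemma itinerary_eq_exact x y m : itinerary_eq x y -> sum_exact x m -> sum_exact y m.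
Proof.
move=> xy; apply: cut_le_exact; first exact: itinerary_eq_cut_le.
exact/itinerary_eq_cut_le/itinerary_eq_sym.
Qed.

Lemma itinerary_eq_op x y : itinerary_eq x y -> itinerary_eq (sum_op x) (sum_op y).
Proof.
move=> xy; have lexy := itinerary_eq_cut_le xy.
have leyx := itinerary_eq_cut_le (itinerary_eq_sym xy).
by case: xy => nxy nyx; split=> lt; [apply: nyx|apply: nxy]; apply: itinerary_lt_op.
Qed.

Definition same_side x y : bool :=
  match x, y with inl _, inl _ | inr _, inr _ => true | _, _ => false end.

Lemma sum_exact_eq x y m : same_side x y -> sum_exact x m -> sum_exact y m -> x = y.
Proof.
case: x y => [a|b] [a'|b'] //= _ [h1 h2] [h3 h4]; congr (_ _).
  exact: (exact_eq rA h1 h2 h3 h4).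
exact: (exact_eq rB h1 h2 h3 h4).
Qed.

(** * The glued order on [A + B] *)

(* [T] marks the points that have to be identified with every point of the
   other structure having the same itinerary. *)
Section Gluing.
Context (T : X -> Prop).
Hypothesis T_exact : forall x m, sum_exact x m -> T x.
Hypothesis T_eq : forall x y, itinerary_eq x y -> T x -> T y.
Hypothesis T_inj : forall x y, same_side x y -> itinerary_eq x y -> T x -> x = y.
Hypothesis T_op : forall x, T x -> T (sum_op x).

(* Points with the same itinerary: below the fixed point the points of [A] come
   first, above it those of [B] do, so that the operation reverses the order. *)
Definition tie_le x y : Prop :=
  match x, y with
  | inl a, inl a' => a <= a'
  | inr b, inr b' => b <= b'
  | inl _, inr _ => T x \/ sum_below x None
  | inr _, inl _ => T x \/ sum_above x None
  end.

Definition glue_le x y : Prop :=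
  itinerary_lt x y \/ itinerary_eq x y /\ tie_le x y.

Lemma itinerary_eq_below x y m : itinerary_eq x y -> sum_below x m -> sum_below y m.
Proof. by move=> /itinerary_eq_sym/itinerary_eq_cut_le/(_ m)[]. Qed.

Lemma itinerary_eq_above x y m : itinerary_eq x y -> sum_above x m -> sum_above y m.
Proof. by move=> /itinerary_eq_cut_le/(_ m)[]. Qed.

Lemma itinerary_eq_trans x y z : itinerary_eq x y -> itinerary_eq y z -> itinerary_eq x z.
Proof.
move=> [nxy nyx] [nyz nzy]; split=> lt.
  by case: (itinerary_lt_split y lt).
by case: (itinerary_lt_split y lt).
Qed.

Lemma tie_le_total x y : itinerary_eq x y -> tie_le x y \/ tie_le y x.
Proof.
move=> xy; case: x y xy => [a|b] [a'|b'] /= xy; try exact/orP/le_total.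
- have /orP[?|/(itinerary_eq_above xy)] := sum_below_or_above (inl a) None; tauto.
- have /orP[/(itinerary_eq_below xy)|?] := sum_below_or_above (inr b) None; tauto.
Qed.

Lemma tie_le_trans x y z : itinerary_eq x y -> itinerary_eq y z ->
  tie_le x y -> tie_le y z -> tie_le x z.
Proof.
move=> xy yz; have xz := itinerary_eq_trans xy yz.
have yx := itinerary_eq_sym xy.
(* Crossing to the other structure and back forces [x = z]: either a point of [T] occurs, or the
   common position is both below and above [None], hence at the fixed point. *)
have round : same_side x z -> T x \/ sum_below x None ->
    T y \/ sum_above y None -> x = z.
  move=> ss; case=> [Tx _|bx []]; first exact: T_inj.
    by move=> /(T_eq yx); exact: T_inj.
  by move=> /(itinerary_eq_above yx) ax; apply: T_inj (T_exact (conj bx ax)).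
have round' : same_side x z -> T x \/ sum_above x None ->
    T y \/ sum_below y None -> x = z.
  move=> ss; case=> [Tx _|ax []]; first exact: T_inj.
    by move=> /(T_eq yx); exact: T_inj.
  by move=> /(itinerary_eq_below yx) bx; apply: T_inj (T_exact (conj bx ax)).
have Tyx := T_eq yx; have byx := @itinerary_eq_below _ _ None yx.
have ayx := @itinerary_eq_above _ _ None yx.
case: x y z xy yz xz yx round round' Tyx byx ayx => [a|b] [a'|b'] [a''|b''] //=
  xy yz xz yx round round' Tyx byx ayx; try exact: le_trans; try tauto.
- by move=> h1 h2; have [->] := round isT h1 h2.
- by move=> h1 h2; have [->] := round' isT h1 h2.
Qed.

Lemma itinerary_lt_eq x y z : itinerary_lt x y -> itinerary_eq y z -> itinerary_lt x z.
Proof. by move=> lt [_ nzy]; case: (itinerary_lt_split z lt). Qed.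

Lemma itinerary_eq_lt x y z : itinerary_eq x y -> itinerary_lt y z -> itinerary_lt x z.
Proof. by move=> [_ nyx] lt; case: (itinerary_lt_split x lt). Qed.

Lemma itinerary_lt_trans x y z : itinerary_lt x y -> itinerary_lt y z -> itinerary_lt x z.
Proof.
by move=> xy yz; case: (itinerary_lt_split z xy) => // /itinerary_lt_asym.
Qed.

Lemma itinerary_trichotomy x y :
  [\/ itinerary_lt x y, itinerary_eq x y | itinerary_lt y x].
Proof.
have [?|?] := pselect (itinerary_lt x y); first exact: Or31.
have [?|?] := pselect (itinerary_lt y x); first exact: Or33.
exact: Or32.
Qed.

Lemma glue_le_total x y : glue_le x y \/ glue_le y x.
Proof.
case: (itinerary_trichotomy x y) => [?|xy|?]; [by left; left| |by right; left].
have yx := itinerary_eq_sym xy.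
by case: (tie_le_total xy) => ?; [left|right]; right.
Qed.

Lemma glue_le_trans x y z : glue_le x y -> glue_le y z -> glue_le x z.
Proof.
move=> [xy|[xy txy]] [yz|[yz tyz]].
- by left; apply: itinerary_lt_trans xy yz.
- by left; apply: itinerary_lt_eq xy yz.
- by left; apply: itinerary_eq_lt xy yz.
- by right; split; [apply: itinerary_eq_trans xy yz|apply: tie_le_trans xy yz _ _].
Qed.

(** Used in both directions, this identifies [i1 c] with [i2 c]; it also settles the collapsed case
    of [glue_le_op]. *)
Lemma exact_glue_le x y m : sum_exact x m -> sum_exact y m -> glue_le x y.
Proof.
move=> ex ey; have xy : itinerary_eq x y by split=> /itinerary_lt_exact; eauto.
right; split=> //; have Tx := T_exact ex.
case: x y ex ey xy Tx => [a|b] [a'|b'] //= ex ey xy Tx; try (by left).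
- by have [->] := @sum_exact_eq (inl a) (inl a') _ isT ex ey.
- by have [->] := @sum_exact_eq (inr b) (inr b') _ isT ex ey.
Qed.

Lemma glue_le_op x y : glue_le x y -> glue_le (sum_op y) (sum_op x).
Proof.
case=> [/itinerary_lt_op_collapse[?|[m [? ?]]]|[xy txy]]; first by left.
  by apply: (@exact_glue_le _ _ m).
right; split; first exact/itinerary_eq_sym/itinerary_eq_op.
have Txy := T_eq xy; have bxy := @itinerary_eq_below _ _ None xy.
have axy := @itinerary_eq_above _ _ None xy.
(* In the mixed cases the operation exchanges the two sides of the fixed point, where [A] and [B]
   are placed in opposite orders. *)
case: x y xy txy Txy bxy axy => [a|b] [a'|b'] /= _ txy Txy bxy axy;
  [exact: rA|case: txy|case: txy|exact: rB].
- by move=> /Txy/T_op; left.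
- by move=> /bxy/rB; right.
- by move=> /Txy/T_op; left.
- by move=> /axy/rA; right.
Qed.

Lemma glue_le_same_side x y : same_side x y -> glue_le x y <-> same_side_le x y.
Proof.
move=> ss; split.
  by case=> [/same_side_itinerary|[_]]; case: x y ss => [a|b] [a'|b'] //= _ /negP;
    rewrite -ltNge => /ltW.
move=> xy; case: (itinerary_trichotomy x y) => [?|eq_xy|/same_side_itinerary //].
  by left.
by right; split=> //; case: x y ss xy {eq_xy} => [a|b] [a'|b'].
Qed.

Definition glue_ulo : unaryLO :=
  quot_ulo sum_op glue_le_total glue_le_trans.

Lemma glue_ulo_amalgam :
  exists (j1 : A -> glue_ulo) (j2 : B -> glue_ulo), amalgam i1 i2 j1 j2.
Proof.
pose pi (x : X) : glue_ulo := quot_pi glue_le_total glue_le_trans x.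
have pi_le x y : pi x <= pi y <-> glue_le x y by exact: quot_pi_le.
have pi_op x : pi (sum_op x) = ulo_op (pi x).
  by apply: quot_pi_op; exact: glue_le_op.
exists (pi \o inl), (pi \o inr).
have e1 (a a' : A) : a <= a' <-> pi (inl a) <= pi (inl a').
  by apply: iff_sym; apply: iff_trans (pi_le _ _) (glue_le_same_side _).
have e2 (b b' : B) : b <= b' <-> pi (inr b) <= pi (inr b').
  by apply: iff_sym; apply: iff_trans (pi_le _ _) (glue_le_same_side _).
split.
- split=> [a a' /= h|a|//]; last exact: pi_op (inl a).
  by apply/le_anti/andP; split; apply/e1; rewrite h.
- split=> [b b' /= h|b|//]; last exact: pi_op (inr b).
  by apply/le_anti/andP; split; apply/e2; rewrite h.
- apply/funext => c /=.
  have c1 : sum_exact (inl (i1 c)) (Some c) by exact: exact_embedding.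
  have c2 : sum_exact (inr (i2 c)) (Some c) by exact: exact_embedding.
  by apply/le_anti/andP; split; apply/pi_le; apply: exact_glue_le; eassumption.
Qed.

Lemma glue_ulo_order_reversing : order_reversing glue_ulo.
Proof. by move=> u v /asboolP uv; apply/quot_pi_le/glue_le_op. Qed.

(** By contraposition, the operation has to reflect [glue_le]: strictness excludes collapsing cuts,
    and closure of [T] under preimages handles the ties. *)
Lemma glue_ulo_strict : strict_order_reversing A -> strict_order_reversing B ->
  (forall x, T (sum_op x) -> T x) -> strict_order_reversing glue_ulo.
Proof.
move=> sA sB T_op_inv u v; rewrite !ltNge; apply: contra => /quot_pi_le guv.
apply/asboolP; move: (quot_repr u) (quot_repr v) guv => x y {u v}.
have above_inv z m : sum_below (sum_op z) (marker_op m) -> sum_above z m.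
  by case: z => ?; exact: above_op_strict.
have below_inv z m : sum_above (sum_op z) (marker_op m) -> sum_below z m.
  by case: z => ?; exact: below_op_strict.
(* If the images were not separated at [marker_op m], both would sit there, and by reflection [z]
   and [w] would both sit at [m]. *)
have lt_op z w : itinerary_lt z w -> itinerary_lt (sum_op w) (sum_op z).
  move=> /itinerary_ltP[zw [|//]] /not_cut_leP[m [zm mw] nex].
  apply: itinerary_lt_cut => /(_ (marker_op m))[h1 h2]; apply: nex.
  by split; [apply/above_inv/h2/sum_above_op|apply/below_inv/h1/sum_below_op].
move=> gxy; case: (itinerary_trichotomy x y) => [lt|xy|]; last by left.
  have := lt_op _ _ lt; case: gxy => [/itinerary_lt_asym //|[[? ?]]] //.
case: gxy => [lt|[_ tgxy]]; first by case: (itinerary_eq_op xy).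
have yx := itinerary_eq_sym xy; right; split=> //.
have Txy := T_eq xy; have bxy := @itinerary_eq_below _ _ None xy.
have axy := @itinerary_eq_above _ _ None xy.
have Tx := T_op_inv x; have bx := above_inv x None; have ax := below_inv x None.
case: x y {lt_op xy yx} tgxy Txy bxy axy Tx bx ax => [a|b] [a'|b'] /=; try tauto.
- by rewrite strict_order_reversingE.
- by rewrite strict_order_reversingE.
Qed.

End Gluing.

End Amalgamation.

(** * The amalgamation property of both classes *)

Lemma AP_LO_r : AP LO_r.
Proof.
move=> A B C i1 i2 rA rB _ i1P i2P.
(* The marker [None] puts the fixed points of [A] and [B] into [T], even when they lie outside
   [C]. *)
pose T x := exists m, sum_exact i1 i2 x m.
have T_exact x m : sum_exact i1 i2 x m -> T x by exists m.
have T_eq x y : itinerary_eq i1 i2 x y -> T x -> T y.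
  by move=> xy [m ex]; exists m; apply: itinerary_eq_exact xy ex.
have T_inj x y : same_side x y -> itinerary_eq i1 i2 x y -> T x -> x = y.
  move=> ss xy [m ex]; apply: (sum_exact_eq rA rB ss ex).
  exact: itinerary_eq_exact xy ex.
have T_op x : T x -> T (sum_op x).
  by move=> [m ex]; exists (marker_op m); apply: sum_exact_op.
have [j1 [j2 jP]] := glue_ulo_amalgam rA rB i1P i2P T_exact T_eq T_inj T_op.
by eexists _, j1, j2; split; [exact: glue_ulo_order_reversing|exact: jP].
Qed.

Lemma AP_LO_sr : AP LO_sr.
Proof.
move=> A B C i1 i2 sA sB _ i1P i2P.
have rA := strict_order_reversing_weak sA.
have rB := strict_order_reversing_weak sB.
pose g : A + B -> A + B := @sum_op A B.
(* Allowing any iterate to reach a marker closes [T] under preimages, as [glue_ulo_strict]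
   requires. *)
pose T x := exists n m, sum_exact i1 i2 (iter n g x) m.
have iter_eq n x y : itinerary_eq i1 i2 x y ->
    itinerary_eq i1 i2 (iter n g x) (iter n g y).
  by move=> xy; elim: n => //= n; exact: itinerary_eq_op.
have T_exact x m : sum_exact i1 i2 x m -> T x by exists 0, m.
have T_eq x y : itinerary_eq i1 i2 x y -> T x -> T y.
  by move=> xy [n [m]]; exists n, m; apply: itinerary_eq_exact (iter_eq n _ _ xy) _.
(* Injectivity pulls an equality of iterates back to the points themselves. *)
have gI : injective g.
  by move=> [a|b] [a'|b'] //= [/strict_order_reversing_inj ->].
have T_inj x y : same_side x y -> itinerary_eq i1 i2 x y -> T x -> x = y.
  move=> ss xy [n [m ex]]; have ey := itinerary_eq_exact (iter_eq n _ _ xy) ex.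
  have ssn : same_side (iter n g x) (iter n g y).
    by elim: n {ex ey} => //= n; case: (iter n g x) (iter n g y) => [?|?] [].
  have : iter n g x = iter n g y by apply: (sum_exact_eq rA rB ssn ex ey).
  by elim: n {ex ey ssn} => //= n IH /gI.
have T_op x : T x -> T (sum_op x).
  move=> [n [m ex]]; exists n, (marker_op m).
  by rewrite -[sum_op x]/(g x) -iterSr; apply: sum_exact_op.
have T_op_inv x : T (sum_op x) -> T x.
  by move=> [n [m ex]]; exists n.+1, m; rewrite iterSr.
have [j1 [j2 jP]] := glue_ulo_amalgam rA rB i1P i2P T_exact T_eq T_inj T_op.
by eexists _, j1, j2; split; [exact: glue_ulo_strict|exact: jP].
Qed.

(** * Failure of strong amalgamation *)

Definition two_ulo : unaryLO := @UnaryLO _ bool negb.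
(** Reversal fixes the midpoint, while the endpoints form a copy of [two_ulo], which has no fixed
    point. *)
Definition three_ulo : unaryLO := @UnaryLO _ 'I_3 (@rev_ord 3).
Definition two_in_three (b : two_ulo) : three_ulo := if b then ord_max else ord0.

Lemma two_in_three_embedding : embedding two_in_three.
Proof.
split.
- by move=> [] [].
- by move=> []; apply/val_inj.
- by move=> [] [].
Qed.

Lemma not_SAP_nonempty (K : unaryLO -> Prop) :
  (forall A, K A -> order_reversing A) -> K two_ulo -> K three_ulo ->
  ~ SAP_nonempty K.
Proof.
move=> Kr K2 K3 sap.
have [D [j1 [j2 [KD [[e1 e2 _] int]]]]] := sap three_ulo three_ulo two_ulo
  two_in_three two_in_three (inhabits true) K3 K3 K2
  two_in_three_embedding two_in_three_embedding.
pose p : three_ulo := Ordinal (isT : (1 < 3)%N).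
have fp : ulo_op p = p by apply/val_inj.
have [inj1 op1 _] := e1; have [_ op2 _] := e2.
have j12 : j1 p = j2 p.
  by apply: (order_reversing_fixpoint_unique (Kr _ KD)); rewrite -?op1 -?op2 fp.
have : (range j1 `&` range j2)%classic (j1 p) by split; [exists p|exists p].
(* Strongness would make the midpoint the image of some [b], that is, an endpoint. *)
by rewrite int => -[_ [b _ <-] /inj1]; case: b.
Qed.

Lemma two_ulo_strict : strict_order_reversing two_ulo.
Proof. by move=> [] []. Qed.

Lemma three_ulo_strict : strict_order_reversing three_ulo.
Proof.
move=> a b; rewrite !ltEord /= => ab; apply: ltn_sub2l => //.
exact: leq_ltn_trans ab (ltn_ord b).
Qed.

Lemma SAP_SAP_nonempty K : SAP K -> SAP_nonempty K.
Proof. by move=> sap A B C i1 i2 _; exact: sap. Qed.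

Theorem theorem4p3 :
  (AP LO_r /\ ~ SAP LO_r /\ ~ SAP_nonempty LO_r) /\
  (AP LO_sr /\ ~ SAP LO_sr /\ ~ SAP_nonempty LO_sr).
Proof.
have s2 := two_ulo_strict; have s3 := three_ulo_strict.
have nr : ~ SAP_nonempty LO_r.
  by apply: not_SAP_nonempty => //; exact: strict_order_reversing_weak.
have nsr : ~ SAP_nonempty LO_sr.
  by apply: not_SAP_nonempty => //; exact: strict_order_reversing_weak.
split; split; [exact: AP_LO_r| |exact: AP_LO_sr|].
- by split=> // /SAP_SAP_nonempty.
- by split=> // /SAP_SAP_nonempty.
Qed.
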